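(* Let $(X,\mathcal M,m)$, $p$, $f$, $\mu$, $h$, $q$ and the Schrödinger perturbation $\tilde p$ of $p$ by $q$ be as described in the context. Then for all $t>0$ and $x\in X$, $$\int_X \tilde p_t(x,y)\,h(y)\,m(dy)\le h(x).$$
   Context: $(X,\mathcal M,m)$ is a $\sigma$-finite measure space. The function $p:(0,\infty)\times X\times X\to[0,\infty]$, $(t,x,y)\mapsto p_t(x,y)$, is $\mathcal B_{(0,\infty)}\times\mathcal M\times\mathcal M$-measurable, symmetric ($p_t(x,y)=p_t(y,x)$), satisfies the Chapman–Kolmogorov equations $\int_X p_s(x,y)p_t(y,z)\,m(dy)=p_{s+t}(x,z)$ for all $x,z\in X$, $s,t>0$, and for every $t>0$, $x\in X$, $p_t(x,y)m(dy)$ is a ($\sigma$-finite) integral kernel. $f:\mathbb R\to[0,\infty)$ is non-decreasing with $f=0$ on $(-\infty,0]$; $f'\ge 0$ denotes its almost-everywhere derivative. $\mu$ is a nonnegative $\sigma$-finite measure on $(X,\mathcal M)$. Put $$p_s\mu(x)=\int_X p_s(x,y)\,\mu(dy),\qquad h(x)=\int_0^\infty f(s)\,p_s\mu(x)\,ds .$$ Define $q:X\to[0,\infty]$ by $q(x)=0$ if $h(x)=0$ or $h(x)=\infty$, and otherwise $$q(x)=\frac1{h(x)}\int_0^\infty f'(s)\,p_s\mu(x)\,ds .$$ The Schrödinger perturbation of $p$ by $q$ is $\tilde p=\sum_{n=0}^\infty p^{(n)}$, where $p^{(0)}_t(x,y)=p_t(x,y)$ and $$p^{(n)}_t(x,y)=\int_0^t\int_X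 p_s(x,z)\,q(z)\,p^{(n-1)}_{t-s}(z,y)\,m(dz)\,ds,\qquad n\ge1.$$ The usual convention $0\cdot\infty=0$ is used. *)

(* Defs.v *)
From HB Require Import structures.
From mathcomp Require Import all_boot all_order all_algebra.
From mathcomp Require Import all_classical all_reals all_analysis.
From mathcomp Require Import measurable_realfun.
Set Implicit Arguments.
Unset Strict Implicit.
Unset Printing Implicit Defensive.
Import Order.TTheory GRing.Theory Num.Theory.
Import numFieldNormedType.Exports.
Local Open Scope classical_set_scope.
Local Open Scope ring_scope.
Local Open Scope ereal_scope.

(* A version of the almost everywhere derivative of a monotone function: the
   derivative where it exists (as a finite limit), and 0 on the remaining
   Lebesgue-null set, where the value of [derive1 f] would be a default one. *)
Definition ae_derive {R : realType} (f : R -> R) (s : R) : R :=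
  (if `[< derivable f s 1 >] then derive1 f s else 0)%R.

(* The time parameter of [p] ranges over (0, +oo): throughout, [p] is a function
   on [R * X * X] of which only the values at positive times are used. *)
Section hardy_weight.
Context {d : measure_display} {X : measurableType d} {R : realType}.
Variables (p : R -> X -> X -> \bar R) (f : R -> R).
Variable mu : {sigma_finite_measure set X -> \bar R}.

Definition pmu (s : R) (x : X) : \bar R := \int[mu]_y p s x y.

Definition hfun (x : X) : \bar R :=
  \int[lebesgue_measure]_(s in `]0%R, +oo[) ((f s)%:E * pmu s x).

Definition qfun (x : X) : \bar R :=
  if (hfun x == 0) || (hfun x == +oo) then 0
  else (hfun x)^-1 *
       \int[lebesgue_measure]_(s in `]0%R, +oo[) ((ae_derive f s)%:E * pmu s x).

End hardy_weight.

Section schroedinger_perturbation.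
Context {d : measure_display} {X : measurableType d} {R : realType}.
Variable m : {sigma_finite_measure set X -> \bar R}.
Variables (p : R -> X -> X -> \bar R) (q : X -> \bar R).

Fixpoint perturb_term (n : nat) (t : R) (x y : X) : \bar R :=
  if n is n'.+1 then
    \int[lebesgue_measure]_(s in `]0%R, t[)
      \int[m]_z (p s x z * q z * perturb_term n' (t - s)%R z y)
  else p t x y.

Definition perturbation (t : R) (x y : X) : \bar R :=
  \sum_(0 <= n <oo) perturb_term n t x y.

End schroedinger_perturbation.

(* Main.v *)
Require Import Defs.
From HB Require Import structures.
From mathcomp Require Import all_boot all_order all_algebra.
From mathcomp Require Import all_classical all_reals all_analysis.
From mathcomp Require Import measurable_realfun.
From mathcomp Require Import lra.
Import Order.TTheory GRing.Theory Num.Theory.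
Import numFieldNormedType.Exports.
Local Open Scope classical_set_scope.
Local Open Scope ring_scope.
Local Open Scope ereal_scope.

(* Set [P_t u (x) = \int p t x y u(y) m(dy)] and
   [g(x) = \int_0^oo f'(s) p_s mu(x) ds], so that [q h <= g].
   By Chapman-Kolmogorov and Tonelli,
     [P_t h (x) = \int f(v - t) p_v mu(x) dv] and
     [\int_0^t P_s g (x) ds = \int (\int_0^t f'(v - s) ds) p_v mu(x) dv],
   and monotonicity of [f] gives
     [\int_0^t f'(v - s) ds + f(v - t) <= f(v)], whence
     [P_t h + \int_0^t P_s (q h) ds <= h].
   If the [N]-th partial sum of the perturbation series maps [h] below [h] at all
   times, this inequality and Duhamel's formula give the same for the [N+1]-st.
   The derivative of [f] enters through an upper bound only, so it is replaced by
   the lower limit [dini f] of its right difference quotients over the steps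
   [1/(n+1)]: this is measurable, and Fatou's lemma bounds its integral without
   Lebesgue's theorem on the differentiation of monotone functions. *)

(** * Comparison of integrals of possibly nonmeasurable functions *)

Section nonmeasurable_monotonicity.
Context d (T : measurableType d) (R : realType).
Variable nu : {measure set T -> \bar R}.
Implicit Types (D : set T) (f g : T -> \bar R).

(* Unlike [ge0_le_integral], no measurability: the integral of a nonnegative
   function is a supremum over the simple functions below it. *)
Lemma ge0_le_integral_nonmeas D f g : (forall x, D x -> 0 <= f x) ->
  (forall x, D x -> f x <= g x) ->
  \int[nu]_(x in D) f x <= \int[nu]_(x in D) g x.
Proof.
move=> f0 fg; rewrite !(integral_mkcond D) !ge0_integralTE.
- apply: ereal_sup_le => _ [h hf <-]; exists h => // x.
  by rewrite (le_trans (hf x))// lee_restrict.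
- by apply: erestrict_ge0 => x Dx; rewrite (le_trans (f0 x Dx)) ?fg.
- exact: erestrict_ge0.
Qed.

(** Serves to pass from the time intervals of the definitions to integrals over the whole line. *)
Lemma ge0_le_integralT_nonmeas D f g : (forall x, D x -> 0 <= f x) ->
  (forall x, D x -> f x <= g x) -> (forall x, 0 <= g x) ->
  \int[nu]_(x in D) f x <= \int[nu]_x g x.
Proof.
move=> f0 fg g0; rewrite (integral_mkcond D).
apply: ge0_le_integral_nonmeas => x _; first exact: erestrict_ge0.
by rewrite patchE; case: ifPn => // /set_mem; exact: fg.
Qed.

End nonmeasurable_monotonicity.

(** * Translation invariance of Lebesgue measure *)

Section lebesgue_translation.
Context {R : realType}.
Notation mu := (@lebesgue_measure R).

Lemma measurable_shift (c : R) : measurable_fun [set: R] (fun x => (x + c)%R).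
Proof. exact: measurable_funD. Qed.

(** By uniqueness of Lebesgue measure: its image under a translation gives half-open intervals their
    length. *)
Lemma lebesgue_measure_shift (c : R) (A : set R) : measurable A ->
  mu ((fun x => (x + c)%R) @^-1` A) = mu A.
Proof.
move=> mA.
pose phi : {mfun measurableTypeR R >-> measurableTypeR R} :=
  HB.pack (fun x : R => (x + c)%R)
    (isMeasurableFun.Build _ _ _ _ _ (measurable_shift c :
      @measurable_fun _ _ (measurableTypeR R) (measurableTypeR R) setT _)).
apply/esym.
apply: (@lebesgue_measure_unique R (pushforward mu phi)) => // X [[a b] _ <-].
rewrite /pushforward [X in _ = mu X](_ : _ = `](a - c)%R, (b - c)%R]%classic).
  rewrite !lebesgue_measure_itv/= !lte_fin ltrD2r; case: ifP => // _.
  by rewrite -!EFinB; congr EFin; lra.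
by apply/seteqP; split => x /=; rewrite !in_itv/= ltrBlDr lerBrDr.
Qed.

Lemma ge0_integral_shift (c : R) (D : set R) (f : R -> \bar R) :
  measurable D -> measurable_fun D f -> (forall x, D x -> 0 <= f x) ->
  \int[mu]_(x in (fun x => (x + c)%R) @^-1` D) f (x + c)%R =
  \int[mu]_(x in D) f x.
Proof.
move=> mD mf f0.
rewrite -(ge0_integral_pushforward (measurable_shift c :
  @measurable_fun _ _ (measurableTypeR R) (measurableTypeR R) setT _))//;
  last first.
  by move=> x /set_mem; exact: f0.
apply: eq_measure_integral => [|mc A mA _]; first exact: measurable_shift.
exact: lebesgue_measure_shift.
Qed.

End lebesgue_translation.

(** * Right difference quotients of a monotone function *)

Section right_difference_quotient.
Context {R : realType}.
Implicit Types (f : R -> R).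
Notation mu := (@lebesgue_measure R).

Definition diffq f (n : nat) (s : R) : R :=
  ((f (s + n.+1%:R^-1) - f s) * n.+1%:R)%R.

(** Extended-real valued, since the quotients may diverge where [f] is not derivable. *)
Definition dini f (s : R) : \bar R := limn_einf (fun n => (diffq f n s)%:E).

Lemma limn_einf_ge0 (u : (\bar R)^nat) : (forall n, 0 <= u n) ->
  0 <= limn_einf u.
Proof.
move=> u0; rewrite limn_einf_lim; apply: lime_ge; first exact: is_cvg_einfs.
by apply: nearW => n; apply: le_ereal_inf_tmp => _ [m _ <-].
Qed.

Lemma measurable_limn_einf d (T : measurableType d) (u : (T -> \bar R)^nat) :
  (forall n, measurable_fun [set: T] (u n)) ->
  measurable_fun [set: T] (fun x => limn_einf (u ^~ x)).
Proof.
move=> mu_; rewrite /limn_einf.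
apply: (measurableT_comp (@oppe_measurable R setT)) => //.
apply: measurable_fun_limn_esup => n.
exact: (measurableT_comp (@oppe_measurable R setT)).
Qed.

Lemma diffq_ge0 f n s : {homo f : x y / (x <= y)%R} -> (0 <= diffq f n s)%R.
Proof. by move=> fh; rewrite mulr_ge0 ?subr_ge0 ?fh// lerDl. Qed.

Lemma dini_ge0 f s : {homo f : x y / (x <= y)%R} -> 0 <= dini f s.
Proof. by move=> fh; apply: limn_einf_ge0 => n; rewrite lee_fin diffq_ge0. Qed.

Lemma measurable_diffq f n : measurable_fun [set: R] f ->
  measurable_fun [set: R] (diffq f n).
Proof.
move=> mf; apply: measurable_funM => //; apply: measurable_funB => //.
exact: (measurableT_comp mf (measurable_shift _)).
Qed.

Lemma measurable_dini f : measurable_fun [set: R] f ->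
  measurable_fun [set: R] (dini f).
Proof.
move=> mf; apply: measurable_limn_einf => n.
by apply/measurable_EFinP; exact: measurable_diffq.
Qed.

(** The derivative is the limit of the quotients along every sequence of nonzero steps tending to 0,
    here [1/(n+1)]. *)
Lemma derivable_dini f s : derivable f s 1 -> dini f s = (derive1 f s)%:E.
Proof.
move=> fs; rewrite /dini.
suff h : (diffq f n s)%:E @[n --> \oo] --> (derive1 f s)%:E.
  by rewrite (cvg_limn_einf_sup h).1.
apply: cvg_EFin; first exact: nearW.
have /cvgr_dnbhsP /(_ (fun n => n.+1%:R^-1)%R) := fs.
rewrite derive1E /derive => h.
have {}h := h (conj (fun n => _) (@cvg_harmonic R)).
apply: cvg_trans (h _); last by move=> n; rewrite invr_eq0 pnatr_eq0.
apply: near_eq_cvg; apply: nearW => n.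
by rewrite /= /diffq invrK scaler1 [(_ + s)%R]addrC mulrC.
Qed.

(** Equality holds where [f] is derivable; elsewhere the left side is 0 by definition. *)
Lemma ae_derive_le_dini f s : {homo f : x y / (x <= y)%R} ->
  (ae_derive f s)%:E <= dini f s.
Proof.
move=> fh; rewrite /ae_derive; case: asboolP => [/derivable_dini->//|_].
exact: dini_ge0.
Qed.

Lemma ae_derive_ge0 f s : {homo f : x y / (x <= y)%R} -> (0 <= ae_derive f s)%R.
Proof.
move=> fh; rewrite /ae_derive; case: asboolP => // /derivable_dini fs.
by rewrite -lee_fin -fs dini_ge0.
Qed.


Lemma le_limn_einf_near (u v : (\bar R)^nat) :
  (\forall n \near \oo, u n <= v n) -> limn_einf u <= limn_einf v.
Proof.
move=> [N _ uv]; rewrite !limn_einf_lim.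
apply: lee_lim; [exact: is_cvg_einfs|exact: is_cvg_einfs|].
exists N => // n /= Nn; apply: le_ereal_inf_tmp => _ [m /= nm <-].
apply: (@le_trans _ _ (u m)); last exact/uv/(leq_trans Nn).
by apply: ereal_inf_lbound; exists m.
Qed.

Lemma limn_einf_le_bound (u : (\bar R)^nat) (c : \bar R) :
  (forall n, u n <= c) -> limn_einf u <= c.
Proof.
move=> uc; rewrite limn_einf_lim; apply: lime_le; first exact: is_cvg_einfs.
apply: nearW => n; apply: le_trans (uc n).
by apply: ereal_inf_lbound; exists n => /=.
Qed.

(* A decreasing step from [c] to [0], supported on the left of [t]: the two
   copies of its integral over the positive half-line cancel, leaving the
   mass [c * e] of the strip [-e < s <= 0]. *)
Lemma integral_backward_difference (H : R -> R) (c t e : R) :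
  {homo H : x y /~ (x <= y)%R} -> (forall s, (s <= 0)%R -> H s = c) ->
  (forall s, (t <= s)%R -> H s = 0%R) -> (0 < t)%R -> (0 < e)%R ->
  \int[mu]_(s in `]0%R, +oo[) (H (s - e) - H s)%:E <= (c * e)%:E.
Proof.
move=> Hni H0 Ht t0 e0.
have Hge0 s : (0 <= H s)%R.
  by rewrite -(Ht (Num.max s t)) ?le_max ?lexx ?orbT// Hni// le_max lexx.
have c0 : (0 <= c)%R by rewrite -(H0 0%R).
have Hlec s : (H s <= c)%R.
  by rewrite -(H0 (Num.min s 0%R)) ?ge_min ?lexx ?orbT// Hni// ge_min lexx.
have mH : measurable_fun setT H.
  by apply: nonincreasing_measurable => // x y; exact: Hni.
have mHe : measurable_fun setT (fun s : R => H (s - e)%R).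
  exact: (measurableT_comp mH (measurable_shift (- e))).
(* [I] is finite because [H] is at most [c] and vanishes from [t] on. It can therefore be added to
   both sides, which leaves only the integral of [H (s - e)] on the left. *)
set I := \int[mu]_(s in `]0%R, +oo[) (H s)%:E.
have I_fin : I \is a fin_num.
  rewrite ge0_fin_numE; last by apply: integral_ge0 => s _; rewrite lee_fin.
  apply: (@le_lt_trans _ _ (\int[mu]_(s in `]0%R, t[) (cst c%:E s))).
    rewrite /I integral_mkcond [leRHS]integral_mkcond.
    apply: ge0_le_integral_nonmeas => s _.
      by apply: erestrict_ge0 => ? _; rewrite lee_fin.
    rewrite !patchE; case: ifPn => [|_]; last first.
      by case: ifPn => //; rewrite lee_fin.
    rewrite inE/= in_itv/= andbT => s0; case: ifPn => [|].
      by rewrite lee_fin.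
    by rewrite notin_setE/= in_itv/= s0/= => /negP; rewrite -leNgt => /Ht ->.
  rewrite integral_cst//= lebesgue_measure_itv/= lte_fin t0 -EFinB -EFinM.
  exact: ltry.
rewrite -(leeD2rE _ _ I_fin) -ge0_integralD//; first last.
- by apply/measurable_EFinP; exact: measurable_funTS.
- by move=> s _; rewrite lee_fin.
- apply/measurable_EFinP; apply: measurable_funTS.
  exact: measurable_funB.
- by move=> s _; rewrite lee_fin subr_ge0 Hni// gerBl ltW.
under eq_integral do rewrite -EFinD subrK.

have -> : `]0%R, +oo[%classic =
    (fun x : R => (x - e)%R) @^-1` `](- e)%R, +oo[ :> set R.
  by apply/seteqP; split => s /=; rewrite !in_itv/= !andbT ltrBrDr addNr.
rewrite (@ge0_integral_shift _ (- e)%R _ (EFin \o H))//; last 2 first.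
- by apply/measurable_EFinP; exact: measurable_funTS.
- by move=> s _; rewrite lee_fin.
(* On the strip [H] equals [c]; the rest of the integral is [I]. *)
have -> : `](- e)%R, +oo[%classic = `](- e)%R, 0%R] `|` `]0%R, +oo[ :> set R.
  by rewrite -itv_bndbnd_setU// bnd_simp ?oppr_le0// ltW.
rewrite ge0_integral_setU//; first last.
- by rewrite disj_set2E; apply/eqP; apply/seteqP; split => // s /=;
    rewrite !in_itv/= andbT => -[/andP[_ s0]]; rewrite ltNge s0.
- by move=> s _; rewrite lee_fin.
- by apply/measurable_EFinP; exact: measurable_funTS.
apply: leeD => //.
rewrite (@eq_integral _ _ _ _ _ (cst c%:E)); last first.
  by move=> s; rewrite inE/= in_itv/= => /andP[_ s0]; rewrite /= H0.
rewrite integral_cst//= lebesgue_measure_itv/= lte_fin oppr_lt0 e0.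
by rewrite -EFinB opprK add0r -EFinM.
Qed.

(** Fatou's lemma for the quotients of [f] after freezing it outside [[v - t, v]]. Without freezing,
    steps beyond [v] would bring in the right limit of [f] at [v], which may exceed [f v]. *)
Lemma integral_dini_le f (v t : R) : {homo f : x y / (x <= y)%R} -> (0 < t)%R ->
  \int[mu]_(s in `]0%R, t[) dini f (v - s)%R + (f (v - t))%:E <= (f v)%:E.
Proof.
move=> fh t0.
(* Time is reversed and clamped to [[0, t]], so [H] decreases from [c] at 0 to 0 at [t]. *)
pose H s := (f (v - Num.min (Num.max s 0) t) - f (v - t))%R.
set c := (f v - f (v - t))%R.
have Hni : {homo H : x y /~ (x <= y)%R}.
  move=> x y yx; rewrite lerD2r fh// lerD2l lerN2.
  by rewrite le_min !ge_min lexx orbT andbT ge_max !le_max yx lexx orbT.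
have H0 s : (s <= 0)%R -> H s = c.
  by move=> s0; rewrite /H max_r// min_l ?subr0// ltW.
have Ht s : (t <= s)%R -> H s = 0%R.
  by move=> ts; rewrite /H max_l ?min_r ?subrr// (le_trans _ ts)// ltW.
have Hin s : (0 <= s <= t)%R -> H s = (f (v - s) - f (v - t))%R.
  by move=> /andP[s0 st]; rewrite /H max_l// min_l.
have mH : measurable_fun setT H.
  by apply: nonincreasing_measurable => // x y; exact: Hni.
pose u n s := ((H (s - n.+1%:R^-1) - H s) * n.+1%:R)%R.
have u_ge0 n s : (0 <= u n s)%R.
  by rewrite mulr_ge0// subr_ge0 Hni// gerBl.
have mu_ n : measurable_fun setT (u n).
  apply: measurable_funM => //; apply: measurable_funB => //.
  exact: (measurableT_comp mH (measurable_shift _)).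
have -> : f v = (c + f (v - t))%R by rewrite subrK.
rewrite EFinD leeD2r//.
apply: (@le_trans _ _
  (\int[mu]_(s in `]0%R, +oo[) limn_einf (fun n => (u n s)%:E))).
  rewrite integral_mkcond [leRHS]integral_mkcond.
  apply: ge0_le_integral_nonmeas => s _.
    by apply: erestrict_ge0 => ? _; exact: dini_ge0.
  rewrite !patchE; case: ifPn => [|_]; last first.
    by case: ifPn => // _; apply: limn_einf_ge0 => n; rewrite lee_fin.
  rewrite inE/= in_itv/= => /andP[s0 st]; rewrite ifT; last first.
    by rewrite inE/= in_itv/= s0.
  (* As soon as [1/(n+1) <= s], both [s] and [s - 1/(n+1)] lie in [[0, t]], and [u n s] is the
     quotient of [f] at [v - s]. *)
  apply: le_limn_einf_near.
  have := near_infty_natSinv_lt (PosNum s0); apply: filterS => n /= /ltW ns.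
  rewrite lee_fin /u /diffq !Hin; [|lra|]; last first.
    by rewrite subr_ge0 ns lerBlDr (le_trans (ltW st))// lerDl.
  rewrite ler_wpM2r//.
  have -> : (v - (s - n.+1%:R^-1) = v - s + n.+1%:R^-1)%R.
    by rewrite opprB addrA addrAC.
  by rewrite opprB addrA subrK.
apply: le_trans (fatou _ _ _ _) _ => //.
- by move=> n; apply/measurable_EFinP; apply: measurable_funTS; exact: mu_.
- by move=> n s _; rewrite lee_fin.
(* Each integral is at most [(n+1) * (c / (n+1)) = c]. *)
apply: limn_einf_le_bound => n.
under eq_integral do rewrite /u EFinM muleC.
rewrite ge0_integralZl_EFin//; first last.
- apply/measurable_EFinP; apply: measurable_funTS; apply: measurable_funB => //.
  exact: (measurableT_comp mH (measurable_shift _)).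
- by move=> s _; rewrite lee_fin subr_ge0 Hni// gerBl.
apply: (@le_trans _ _ (n.+1%:R%:E * (c * n.+1%:R^-1)%:E)).
  by rewrite lee_wpmul2l ?lee_fin// (integral_backward_difference _ _ t)//
    ?invr_gt0.
by rewrite -EFinM mulrCA divff ?mulr1// pnatr_eq0.
Qed.

End right_difference_quotient.

(** * Curried forms of Tonelli's theorem *)

Section tonelli.
Context {R : realType}.

Lemma measurable_integral d1 d2 (T : measurableType d1) (Y : measurableType d2)
    (nu : {sigma_finite_measure set Y -> \bar R}) (F : T -> Y -> \bar R) :
  measurable_fun [set: T * Y] (fun u => F u.1 u.2) ->
  (forall x y, 0 <= F x y) ->
  measurable_fun [set: T] (fun x => \int[nu]_y F x y).
Proof.
move=> mF F0.
exact: (@measurable_fun_fubini_tonelli_F _ _ _ _ _ nu (fun u => F u.1 u.2)).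
Qed.

Lemma measurable_integral_set d1 d2 (T : measurableType d1)
    (Y : measurableType d2) (nu : {sigma_finite_measure set Y -> \bar R})
    (D : set Y) (F : T -> Y -> \bar R) :
  measurable D ->
  measurable_fun [set: T * Y] (fun u => F u.1 u.2) ->
  (forall x y, 0 <= F x y) ->
  measurable_fun [set: T] (fun x => \int[nu]_(y in D) F x y).
Proof.
move=> mD mF F0; under eq_fun do rewrite integral_mkcond epatch_indic.
apply: measurable_integral => [|x y]; last by rewrite mule_ge0// lee_fin.
rewrite /=; apply: emeasurable_funM => //; apply/measurable_EFinP.
exact: (measurableT_comp (measurable_indic mD)).
Qed.

Lemma tonelli d1 d2 (T : measurableType d1) (Y : measurableType d2)
    (n1 : {sigma_finite_measure set T -> \bar R})
    (n2 : {sigma_finite_measure set Y -> \bar R}) (F : T -> Y -> \bar R) :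
  measurable_fun [set: T * Y] (fun u => F u.1 u.2) ->
  (forall x y, 0 <= F x y) ->
  \int[n1]_x \int[n2]_y F x y = \int[n2]_y \int[n1]_x F x y.
Proof.
by move=> mF F0; exact: (@fubini_tonelli _ _ _ _ _ n1 n2 (fun u => F u.1 u.2)).
Qed.

Lemma tonelli_setl d1 d2 (T : measurableType d1) (Y : measurableType d2)
    (n1 : {sigma_finite_measure set T -> \bar R})
    (n2 : {sigma_finite_measure set Y -> \bar R}) (D : set T)
    (F : T -> Y -> \bar R) :
  measurable D ->
  measurable_fun [set: T * Y] (fun u => F u.1 u.2) ->
  (forall x y, 0 <= F x y) ->
  \int[n1]_(x in D) \int[n2]_y F x y = \int[n2]_y \int[n1]_(x in D) F x y.
Proof.
move=> mD mF F0; rewrite integral_mkcond.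
under [RHS]eq_integral do rewrite integral_mkcond epatch_indic.
rewrite -tonelli.
- apply: eq_integral => x _; rewrite epatch_indic ge0_integralZr//.
  + exact: (measurableT_comp mF (measurable_fun_pair _ _)).
  + by rewrite lee_fin.
- rewrite /=; apply: emeasurable_funM => //; apply/measurable_EFinP.
  exact: (measurableT_comp (measurable_indic mD)).
- by move=> x y; rewrite mule_ge0// lee_fin.
Qed.

End tonelli.

(** * Kernels extended by zero to nonpositive times *)

Section kernel.
Context {R : realType} {d : measure_display} {X : measurableType d}.
Variables (m mu : {sigma_finite_measure set X -> \bar R}).
Variable P : R -> X -> X -> \bar R.
Hypothesis P_ge0 : forall s x y, 0 <= P s x y.
Hypothesis P_meas :
  measurable_fun [set: R * X * X] (fun u => P u.1.1 u.1.2 u.2).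
Hypothesis P_le0 : forall s x y, (s <= 0)%R -> P s x y = 0.
(** Only an inequality: for [s <= 0] or [t <= 0] the left side vanishes, while [s + t] may be
    positive. *)
Hypothesis P_CK : forall s t x z,
  \int[m]_y (P s x y * P t y z) <= P (s + t) x z.

Lemma measurable_kernel d' (T : measurableType d') (a : T -> R) (b c : T -> X) :
  measurable_fun [set: T] a -> measurable_fun [set: T] b ->
  measurable_fun [set: T] c ->
  measurable_fun [set: T] (fun u => P (a u) (b u) (c u)).
Proof.
move=> ma mb mc.
exact: (measurableT_comp P_meas
  (measurable_fun_pair (measurable_fun_pair ma mb) mc)).
Qed.

Lemma pmu_ge0 s x : 0 <= pmu P mu s x.
Proof. exact: integral_ge0. Qed.

Lemma measurable_pmu d' (T : measurableType d') (a : T -> R) (b : T -> X) :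
  measurable_fun [set: T] a -> measurable_fun [set: T] b ->
  measurable_fun [set: T] (fun u => pmu P mu (a u) (b u)).
Proof.
move=> ma mb; apply: (@measurable_integral R) => //.
apply: measurable_kernel => //; exact: measurableT_comp.
Qed.

Lemma kernel_pmu s u x :
  \int[m]_y (P s x y * pmu P mu u y) <= pmu P mu (s + u) x.
Proof.
have E y : P s x y * pmu P mu u y = \int[mu]_z (P s x y * P u y z).
  by rewrite ge0_integralZl//; exact: measurable_kernel.
under eq_integral do rewrite E.
rewrite tonelli/=; first last.
- by move=> *; rewrite mule_ge0.
- by apply: emeasurable_funM; apply: measurable_kernel.
apply: ge0_le_integral_nonmeas => z _; last exact: P_CK.
by apply: integral_ge0 => y _; rewrite mule_ge0.
Qed.

(* [weighted w] is the function [h] of the theorem for [w = f]. *)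
Definition weighted (w : R -> \bar R) (x : X) : \bar R :=
  \int[lebesgue_measure]_s (w s * pmu P mu s x).

(** * Action of the kernel on weighted time integrals *)

Section weight.
Variable w : R -> \bar R.
Hypothesis w_ge0 : forall s, 0 <= w s.
Hypothesis w_meas : measurable_fun [set: R] w.

Lemma weighted_ge0 x : 0 <= weighted w x.
Proof. by apply: integral_ge0 => s _; rewrite mule_ge0// pmu_ge0. Qed.

Lemma measurable_weighted : measurable_fun [set: X] (weighted w).
Proof.
apply: (@measurable_integral R) => [|x s]; last by rewrite mule_ge0// pmu_ge0.
by apply: emeasurable_funM; [exact: measurableT_comp|exact: measurable_pmu].
Qed.

(** Tonelli and [kernel_pmu] raise the time [u] to [s + u]; the substitution [v = u + s] moves the
    shift to the weight. *)
Lemma kernel_weighted s x :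
  \int[m]_y (P s x y * weighted w y) <=
  \int[lebesgue_measure]_v (w (v - s)%R * pmu P mu v x).
Proof.
have E y : P s x y * weighted w y =
    \int[lebesgue_measure]_u (w u * (P s x y * pmu P mu u y)).
  under [RHS]eq_integral do rewrite muleCA.
  rewrite ge0_integralZl//; last by move=> u _; rewrite mule_ge0// pmu_ge0.
  by apply: emeasurable_funM => //; exact: measurable_pmu.
under eq_integral do rewrite E.
rewrite (@tonelli R _ _ _ _ _ lebesgue_measure)/=; first last.
- by move=> y u; rewrite !mule_ge0// pmu_ge0.
- apply: emeasurable_funM; first exact: measurableT_comp.
  by apply: emeasurable_funM; [exact: measurable_kernel|exact: measurable_pmu].
rewrite -(@ge0_integral_shift R s setT
  (fun v => w (v - s)%R * pmu P mu v x))//; first last.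
- by move=> v _; rewrite mule_ge0// pmu_ge0.
- apply: emeasurable_funM; last exact: measurable_pmu.
  exact: (measurableT_comp w_meas (measurable_shift _)).
rewrite preimage_setT; apply: ge0_le_integral_nonmeas => u _.
  by apply: integral_ge0 => y _; rewrite !mule_ge0// pmu_ge0.
rewrite addrK ge0_integralZl//.
- by rewrite lee_wpmul2l// addrC kernel_pmu.
- by apply: emeasurable_funM; [exact: measurable_kernel|exact: measurable_pmu].
- by move=> y _; rewrite mule_ge0// pmu_ge0.
Qed.

End weight.

(** * Excessivity of [h] with the remainder given by [g] *)

Section monotone_weight.
Variable f : R -> R.
Hypothesis f_ge0 : forall s, (0 <= f s)%R.
Hypothesis f_ndecr : {homo f : x y / (x <= y)%R}.

Let h := weighted (EFin \o f).
Let g := weighted (dini f).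

Let f_meas : measurable_fun [set: R] f.
Proof. exact: nondecreasing_measurable. Qed.

Let ef_ge0 s : 0 <= (EFin \o f) s. Proof. by rewrite lee_fin. Qed.

Let ef_meas : measurable_fun [set: R] (EFin \o f).
Proof. exact/measurable_EFinP. Qed.

(** Both terms become integrals against [pmu P mu v x] in [v]; by [integral_dini_le] their
    coefficients add up to at most [f v]. *)
Lemma excessive_bound t x : (0 < t)%R ->
  \int[m]_y (P t x y * h y) +
  \int[lebesgue_measure]_(s in `]0%R, t[) \int[m]_z (P s x z * g z) <= h x.
Proof.
move=> t0.
have dm : measurable_fun setT (dini f) by exact: measurable_dini.
have dm2 : measurable_fun [set: R * R] (fun u => dini f (u.2 - u.1)%R).
  by apply: (measurableT_comp dm); exact: measurable_funB.
have d0 s : 0 <= dini f s by exact: dini_ge0.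
apply: (@le_trans _ _ (
    \int[lebesgue_measure]_v ((f (v - t))%:E * pmu P mu v x) +
    \int[lebesgue_measure]_(s in `]0%R, t[)
      \int[lebesgue_measure]_v (dini f (v - s)%R * pmu P mu v x))).
  apply: leeD; first exact: (kernel_weighted (EFin \o f)).
  apply: ge0_le_integral_nonmeas => s _; last exact: kernel_weighted.
  by apply: integral_ge0 => z _; rewrite mule_ge0// weighted_ge0.
rewrite tonelli_setl//=; first last.
- by move=> s v; rewrite mule_ge0// pmu_ge0.
- by apply: emeasurable_funM => //; exact: measurable_pmu.
have mK : measurable_fun [set: R * R]
    (fun u => dini f (u.1 - u.2)%R * pmu P mu u.1 x).
  apply: emeasurable_funM; last exact: measurable_pmu.
  by apply: (measurableT_comp dm); exact: measurable_funB.
rewrite -ge0_integralD//; first last.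
- apply: (@measurable_integral_set R _ _ (measurableTypeR R) (measurableTypeR R)
    lebesgue_measure) => //= v s.
  by rewrite mule_ge0// pmu_ge0.
- by move=> v _; apply: integral_ge0 => s _; rewrite mule_ge0// pmu_ge0.
- apply: emeasurable_funM; last exact: measurable_pmu.
  apply/measurable_EFinP; exact: (measurableT_comp f_meas (measurable_shift _)).
- by move=> v _; rewrite mule_ge0 ?lee_fin// pmu_ge0.
apply: ge0_le_integral_nonmeas => v _.
  rewrite adde_ge0//; first by rewrite mule_ge0 ?lee_fin// pmu_ge0.
  by apply: integral_ge0 => s _; rewrite mule_ge0// pmu_ge0.
rewrite ge0_integralZr//.
- rewrite -ge0_muleDl ?lee_fin//; last by apply: integral_ge0.
  by rewrite lee_wpmul2r ?pmu_ge0// addeC integral_dini_le.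
- apply: measurable_funTS; apply: (measurableT_comp dm).
  exact: measurable_funB.
- exact: pmu_ge0.
Qed.

End monotone_weight.

(** * Perturbation series applied to [h] *)

Section perturbation.
Variables q h : X -> \bar R.
Hypothesis q_ge0 : forall x, 0 <= q x.
Hypothesis h_ge0 : forall x, 0 <= h x.
Hypothesis q_meas : measurable_fun [set: X] q.
Hypothesis h_meas : measurable_fun [set: X] h.

(* [perturb_term] as a convolution over all times: since [P] vanishes at
   nonpositive times, the integrand vanishes unless [0 < s < t]. *)
Fixpoint conv_term (n : nat) (t : R) (x y : X) : \bar R :=
  if n is n'.+1 then
    \int[lebesgue_measure]_s \int[m]_z
      (P s x z * q z * conv_term n' (t - s)%R z y)
  else P t x y.

Lemma conv_term_ge0 n t x y : 0 <= conv_term n t x y.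
Proof.
elim: n t x y => [|n IH] t x y //=.
by apply: integral_ge0 => s _; apply: integral_ge0 => z _; rewrite !mule_ge0.
Qed.

(** The vanishing of [conv_term n] is a premise so that this can serve in the induction that proves
    it. *)
Lemma conv_integrand_eq0 n s t x y z :
  (forall t x y, (t <= 0)%R -> conv_term n t x y = 0) ->
  ((s <= 0) || (t <= s))%R ->
  P s x z * q z * conv_term n (t - s)%R z y = 0.
Proof.
move=> IH /orP[s0|ts]; first by rewrite P_le0// !mul0e.
by rewrite IH ?mule0// subr_le0.
Qed.

Lemma conv_term_le0 n t x y : (t <= 0)%R -> conv_term n t x y = 0.
Proof.
elim: n t x y => [|n IH] t x y t0 /=; first exact: P_le0.
apply: integral0_eq => s _; apply: integral0_eq => z _.
(* If [s > 0], then [t <= 0 < s], so the second alternative holds. *)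
rewrite conv_integrand_eq0//; have [//|s0] := leP s 0%R.
by rewrite (le_trans t0)// ltW.
Qed.

(** Stated for composites because the induction evaluates the previous term at time [t - s] and at
    projections from a larger product. *)
Lemma measurable_conv_term n d' (T : measurableType d') (a : T -> R)
    (b c : T -> X) :
  measurable_fun [set: T] a -> measurable_fun [set: T] b ->
  measurable_fun [set: T] c ->
  measurable_fun [set: T] (fun u => conv_term n (a u) (b u) (c u)).
Proof.
elim: n d' T a b c => [|n IH] d' T a b c ma mb mc /=.
  exact: measurable_kernel.
apply: (@measurable_integral R _ _ _ (measurableTypeR R)
  lebesgue_measure) => /=; last first.
  by move=> u s; apply: integral_ge0 => z _; rewrite !mule_ge0// conv_term_ge0.
apply: (@measurable_integral R _ _ _ _ m) => /=; last first.
  by move=> u s; rewrite !mule_ge0// conv_term_ge0.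
apply: emeasurable_funM; last first.
  apply: IH => //.
  - apply: measurable_funB.
      exact: (measurableT_comp ma
        (measurableT_comp measurable_fst measurable_fst)).
    exact: (measurableT_comp measurable_snd measurable_fst).
  - exact: (measurableT_comp mc
      (measurableT_comp measurable_fst measurable_fst)).
apply: emeasurable_funM; last exact: measurableT_comp.
apply: measurable_kernel => //.
- exact: (measurableT_comp measurable_snd measurable_fst).
- exact: (measurableT_comp mb (measurableT_comp measurable_fst measurable_fst)).
Qed.

Definition conv_apply n t x := \int[m]_y (conv_term n t x y * h y).

Lemma conv_apply_ge0 n t x : 0 <= conv_apply n t x.
Proof. by apply: integral_ge0 => y _; rewrite mule_ge0// conv_term_ge0. Qed.

Lemma conv_apply_le0 n t x : (t <= 0)%R -> conv_apply n t x = 0.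
Proof.
by move=> t0; apply: integral0_eq => y _; rewrite conv_term_le0// mul0e.
Qed.

Lemma measurable_conv_apply n d' (T : measurableType d') (a : T -> R)
    (b : T -> X) :
  measurable_fun [set: T] a -> measurable_fun [set: T] b ->
  measurable_fun [set: T] (fun u => conv_apply n (a u) (b u)).
Proof.
move=> ma mb; apply: (@measurable_integral R) => [|u y]; last first.
  by rewrite mule_ge0// conv_term_ge0.
apply: emeasurable_funM; last exact: measurableT_comp.
by apply: measurable_conv_term => //; exact: measurableT_comp.
Qed.

(** Duhamel's formula: two applications of Tonelli, exchanging [y] with [s] and then with [z], bring
    the integration of [h] innermost. *)
Lemma conv_applyS n t x : conv_apply n.+1 t x =
  \int[lebesgue_measure]_s \int[m]_z (P s x z * q z * conv_apply n (t - s)%R z).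
Proof.
pose L s z y := P s x z * q z * conv_term n (t - s)%R z y.
have L0 s z y : 0 <= L s z y by rewrite !mule_ge0// conv_term_ge0.
have mL d' (T : measurableType d') (a : T -> R) (b c : T -> X) :
    measurable_fun [set: T] a -> measurable_fun [set: T] b ->
    measurable_fun [set: T] c ->
    measurable_fun [set: T] (fun u => L (a u) (b u) (c u)).
  move=> ma mb mc; apply: emeasurable_funM; last first.
    by apply: measurable_conv_term => //; exact: measurable_funB.
  by apply: emeasurable_funM; [exact: measurable_kernel|exact: measurableT_comp].
have mLz y : measurable_fun [set: R] (fun s => \int[m]_z L s z y).
  apply: (@measurable_integral R _ _ (measurableTypeR R)) => //.
  by apply: mL.
have E y : conv_term n.+1 t x y * h y =
    \int[lebesgue_measure]_s \int[m]_z (L s z y * h y).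
  rewrite /= -ge0_integralZr//; first last.
  - by move=> s _; apply: integral_ge0 => z _; exact: L0.
  - exact: mLz.
  apply: eq_integral => s _; rewrite -ge0_integralZr//; first exact: mL.
  by move=> z _; exact: L0.
rewrite /conv_apply.
under eq_integral do rewrite E.
rewrite (@tonelli R _ _ _ _ m lebesgue_measure)/=; first last.
- by move=> y s; apply: integral_ge0 => z _; rewrite mule_ge0.
- apply: (@measurable_integral R _ _ _ _ m) => [|u z]; last by rewrite mule_ge0.
  apply: emeasurable_funM; last first.
    exact: (measurableT_comp h_meas
      (measurableT_comp measurable_fst measurable_fst)).
  apply: mL => //.
  + exact: (measurableT_comp measurable_snd measurable_fst).
  + exact: (measurableT_comp measurable_fst measurable_fst).
apply: eq_integral => s _; rewrite tonelli/=; first last.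
- by move=> y z; rewrite mule_ge0.
- apply: emeasurable_funM; first exact: mL.
  exact: (measurableT_comp h_meas measurable_fst).
apply: eq_integral => z _.
under eq_integral do rewrite /L -muleA.
rewrite ge0_integralZl ?mule_ge0//.
- by apply: emeasurable_funM => //; exact: measurable_conv_term.
- by move=> y _; rewrite mule_ge0// conv_term_ge0.
Qed.

Hypothesis qh_excessive : forall t x, (0 < t)%R ->
  \int[m]_y (P t x y * h y) +
  \int[lebesgue_measure]_(s in `]0%R, t[) \int[m]_z (P s x z * (q z * h z))
    <= h x.

(** Induction on [N] for all times at once. The zeroth term is [P_t h]; by [conv_applyS] the others
    integrate [P_s q] against the shorter sum at time [t - s], which is at most [h]. *)
Lemma sum_conv_apply_le N t x : \sum_(n < N) conv_apply n t x <= h x.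
Proof.
elim: N t x => [|N IH] t x; first by rewrite big_ord0.
have [t0|t0] := leP t 0%R.
  by rewrite big1// => n _; exact: conv_apply_le0.
rewrite big_ord_recl/=; apply: le_trans (qh_excessive _ _ t0).
apply: leeD => //.
under eq_bigr do rewrite conv_applyS.
have mK n d' (T : measurableType d') (a : T -> R) (b : T -> X) :
    measurable_fun [set: T] a -> measurable_fun [set: T] b ->
    measurable_fun [set: T]
      (fun u => P (a u) x (b u) * q (b u) * conv_apply n (t - a u)%R (b u)).
  move=> ma mb; apply: emeasurable_funM; last first.
    by apply: measurable_conv_apply => //; exact: measurable_funB.
  by apply: emeasurable_funM; [exact: measurable_kernel|exact: measurableT_comp].
have K0 n s z : 0 <= P s x z * q z * conv_apply n (t - s)%R z.
  by rewrite !mule_ge0// conv_apply_ge0.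
rewrite -ge0_integral_sum//; first last.
- by move=> n s _; apply: integral_ge0 => z _; exact: K0.
- move=> n; apply: (@measurable_integral R _ _ (measurableTypeR R)) => //.
  exact: mK.
rewrite [leRHS]integral_mkcond; apply: ge0_le_integral_nonmeas => s _.
  by rewrite sume_ge0// => n _; apply: integral_ge0 => z _; exact: K0.
rewrite -ge0_integral_sum//; last by move=> n; exact: mK.
rewrite patchE; case: ifPn => [|].
  rewrite inE/= in_itv/= => /andP[s0 st].
  apply: ge0_le_integral_nonmeas => z _; first exact: sume_ge0.
  rewrite -ge0_sume_distrr; last by move=> n _; exact: conv_apply_ge0.
  by rewrite -muleA lee_wpmul2l// lee_wpmul2l.
(* Outside []0, t[] either [P s] or the sum at time [t - s] vanishes. *)
rewrite notin_setE/= in_itv/= => /negP; rewrite negb_and -!leNgt => sE.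
rewrite integral0_eq// => z _; rewrite big1// => n _.
case/orP: sE => [s0|ts]; first by rewrite P_le0// !mul0e.
by rewrite conv_apply_le0 ?mule0// subr_le0.
Qed.

(** A finite [a] passes through the sum. For [a = +oo], one nonzero term makes the right side
    infinite; if all terms vanish, the left side is [0 * +oo = 0]. *)
Lemma nneseries_mulr_le (u : (\bar R)^nat) (a : \bar R) :
  (forall n, 0 <= u n) -> 0 <= a ->
  (\sum_(n <oo) u n) * a <= \sum_(n <oo) (u n * a).
Proof.
move=> u0; case: a => [r r0|_|//].
  rewrite muleC -nneseriesZl//; apply: lee_nneseries => [n _ _|n _].
    by rewrite mule_ge0.
  by rewrite muleC.
have [u_eq0|/existsNP[n /eqP un0]] := pselect (forall n, u n = 0).
  by rewrite eseries0 ?mul0e// ?nneseries_ge0// => n *; rewrite ?mule_ge0.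
apply: (@le_trans _ _ (u n * +oo)).
  by rewrite (@gt0_muley _ (u n)) ?leey// lt0e un0 u0.
have := @nneseries_lim_ge R (fun k => u k * +oo) xpredT 0 n.+1.
rewrite big_nat_recr//=; move=> H; apply: le_trans (H _); last first.
  by move=> k _; rewrite mule_ge0.
by rewrite leeDr// sume_ge0// => k _; rewrite mule_ge0.
Qed.

(** Sum and integral are exchanged by nonnegativity, and every partial sum is at most [h x]. *)
Lemma integral_conv_series_le t x :
  \int[m]_y ((\sum_(n <oo) conv_term n t x y) * h y) <= h x.
Proof.
apply: (@le_trans _ _ (\int[m]_y \sum_(n <oo) (conv_term n t x y * h y))).
  apply: ge0_le_integral_nonmeas => y _.
    by rewrite mule_ge0// nneseries_ge0// => n *; exact: conv_term_ge0.
  by apply: nneseries_mulr_le => // n; exact: conv_term_ge0.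
rewrite integral_nneseries//; first last.
- by move=> n y _; rewrite mule_ge0// conv_term_ge0.
- by move=> n; apply: emeasurable_funM => //; exact: measurable_conv_term.
apply: lime_le.
  by apply: is_cvg_nneseries => n *; exact: conv_apply_ge0.
by apply: nearW => N; rewrite big_mkord; exact: sum_conv_apply_le.
Qed.

End perturbation.

End kernel.

(** * The quotient [g / h] as a potential *)

Section dominating_potential.
Context {R : realType} {d : measure_display} {X : measurableType d}.
Implicit Types h g : X -> \bar R.

(** The formula of [qfun] with its numerator [g] left free, so that a measurable majorant can
    replace the integral of the derivative. *)
Definition potential h g (x : X) : \bar R :=
  if (h x == 0) || (h x == +oo) then 0 else (h x)^-1 * g x.

Lemma potential_ge0 h g x : (forall x, 0 <= h x) -> (forall x, 0 <= g x) ->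
  0 <= potential h g x.
Proof.
move=> h0 g0; rewrite /potential; case: ifPn => // _.
by rewrite mule_ge0// inve_ge0.
Qed.

Lemma le_potential h g g' x : (forall x, 0 <= h x) -> g x <= g' x ->
  potential h g x <= potential h g' x.
Proof.
move=> h0 gg'; rewrite /potential; case: ifPn => // _.
by rewrite lee_wpmul2l// inve_ge0.
Qed.

(** [h x] cancels when it is positive and finite; otherwise the left side is 0. *)
Lemma potentialM_le h g x : (forall x, 0 <= h x) -> (forall x, 0 <= g x) ->
  potential h g x * h x <= g x.
Proof.
move=> h0 g0; rewrite /potential; case: ifPn => [_|]; first by rewrite mul0e.
rewrite negb_or => /andP[hx0 hxoo]; rewrite muleAC mulVe ?mul1e//.
by rewrite ge0_fin_numE// ltey.
Qed.

Lemma measurable_potential h g : (forall x, 0 <= h x) ->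
  measurable_fun [set: X] h -> measurable_fun [set: X] g ->
  measurable_fun [set: X] (potential h g).
Proof.
move=> h0 mh mg.
(* In the second branch [h x] is positive and finite, so its inverse is a real power, whose
   measurability is known. *)
rewrite (_ : potential h g = fun x => if (h x == 0) || (h x == +oo) then 0 else
    (fine (h x) `^ (- 1))%:E * g x); last first.
  apply/funext => x; rewrite /potential; case: ifPn => //.
  rewrite negb_or => /andP[hx0 hxoo]; congr (_ * _).
  move: (h0 x) hx0 hxoo; case: (h x) => // r r0; rewrite eqe => rn0 _.
  by rewrite inver (negbTE rn0)/= powR_inv1.
apply: measurable_fun_ifT => //.
- by apply: measurable_or; exact: measurable_fun_eqe.
- apply: emeasurable_funM => //; apply/measurable_EFinP.
  apply: (measurableT_comp (@measurable_powR R (-1)%R)).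
  exact: (measurableT_comp (@fine_measurable _ setT _)).
Qed.

End dominating_potential.

(** * Passage from [p] at positive times to its extension by zero *)

Section positive_times.
Context {R : realType} {d : measure_display} {X : measurableType d}.
Variable p : R -> X -> X -> \bar R.

Definition pos_time (s : R) (x y : X) : \bar R :=
  if (0 < s)%R then p s x y else 0.

Lemma pos_timeE s x y : (0 < s)%R -> pos_time s x y = p s x y.
Proof. by rewrite /pos_time => ->. Qed.

Lemma pos_time_le0 s x y : (s <= 0)%R -> pos_time s x y = 0.
Proof. by rewrite /pos_time leNgt => /negbTE ->. Qed.

Hypothesis p_ge0 : forall s x y, (0 < s)%R -> 0 <= p s x y.

Lemma pos_time_ge0 s x y : 0 <= pos_time s x y.
Proof. by rewrite /pos_time; case: ifPn => // /p_ge0. Qed.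

Lemma measurable_pos_time :
  measurable_fun [set u : R * X * X | (0 < u.1.1)%R]
    (fun u : R * X * X => p u.1.1 u.1.2 u.2) ->
  measurable_fun [set: R * X * X] (fun u => pos_time u.1.1 u.1.2 u.2).
Proof.
move=> mp; set D := [set u : R * X * X | (0 < u.1.1)%R].
have mD : measurable D.
  have : measurable_fun [set: R * X * X] (fun u => u.1.1).
    exact: (measurableT_comp measurable_fst measurable_fst).
  move=> /(_ measurableT `]0%R, +oo[%classic (measurable_itv _)).
  rewrite setTI; congr measurable; apply/seteqP.
  by split => u /=; rewrite in_itv/= andbT.
have -> : (fun u : R * X * X => pos_time u.1.1 u.1.2 u.2) =
    (fun u => p u.1.1 u.1.2 u.2) \_ D.
  apply/funext => u; rewrite patchE /pos_time; case: ifPn => u0.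
    by rewrite mem_set.
  by rewrite memNset//; exact/negP.
exact/(measurable_restrictT _ mD).
Qed.

Variables (f : R -> R) (mu : {sigma_finite_measure set X -> \bar R}).

Lemma pmu_pos_time s x : (0 < s)%R -> pmu pos_time mu s x = pmu p mu s x.
Proof. by move=> s0; apply: eq_integral => y _; rewrite pos_timeE. Qed.

Lemma hfun_weighted x : (forall s, (s <= 0)%R -> f s = 0%R) ->
  hfun p f mu x = weighted mu pos_time (EFin \o f) x.
Proof.
move=> f0; rewrite /hfun integral_mkcond; apply: eq_integral => s _.
rewrite patchE; case: ifPn => [|].
  by rewrite inE/= in_itv/= andbT => /pmu_pos_time ->.
rewrite notin_setE/= in_itv/= andbT => /negP; rewrite -leNgt => /f0 ->.
by rewrite mul0e.
Qed.

Hypothesis f_ndecr : {homo f : x y / (x <= y)%R}.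

Let pmu_p_ge0 s x : (0 < s)%R -> 0 <= pmu p mu s x.
Proof. by move=> s0; apply: integral_ge0 => y _; exact: p_ge0. Qed.

Lemma ae_derive_integral_ge0 x :
  0 <= \int[lebesgue_measure]_(s in `]0%R, +oo[)
    ((ae_derive f s)%:E * pmu p mu s x).
Proof.
apply: integral_ge0 => s /=; rewrite in_itv/= andbT => s0.
by rewrite mule_ge0 ?pmu_p_ge0// lee_fin ae_derive_ge0.
Qed.

(** Here [dini f] replaces the derivative, by pointwise domination at positive times. *)
Lemma ae_derive_integral_le x :
  \int[lebesgue_measure]_(s in `]0%R, +oo[)
    ((ae_derive f s)%:E * pmu p mu s x) <=
  weighted mu pos_time (dini f) x.
Proof.
apply: ge0_le_integralT_nonmeas => [s|s|s].
- rewrite /= in_itv/= andbT => s0.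
  by rewrite mule_ge0 ?pmu_p_ge0// lee_fin ae_derive_ge0.
- rewrite /= in_itv/= andbT => s0.
  by rewrite pmu_pos_time// lee_wpmul2r ?pmu_p_ge0// ae_derive_le_dini.
- rewrite mule_ge0 ?dini_ge0//.
  by apply: integral_ge0 => y _; exact: pos_time_ge0.
Qed.

Variable m : {sigma_finite_measure set X -> \bar R}.
Variables q q' : X -> \bar R.
Hypothesis q_ge0 : forall x, 0 <= q x.
Hypothesis qq' : forall x, q x <= q' x.

Lemma perturb_term_ge0 n t x y : (0 < t)%R -> 0 <= perturb_term m p q n t x y.
Proof.
elim: n t x y => [|n IH] t x y t0 /=; first exact: p_ge0.
apply: integral_ge0 => s; rewrite /= in_itv/= => /andP[s0 st].
by apply: integral_ge0 => z _; rewrite !mule_ge0 ?p_ge0 ?IH// subr_gt0.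
Qed.

(** Passes from [q], whose measurability is not established, to a majorant [q']; the integrands are
    compared pointwise by induction on [n]. *)
Lemma perturb_term_le n t x y : (0 < t)%R ->
  perturb_term m p q n t x y <= conv_term m pos_time q' n t x y.
Proof.
elim: n t x y => [|n IH] t x y t0; first by rewrite /= pos_timeE.
have q'0 z : 0 <= q' z by exact: le_trans (qq' z).
apply: ge0_le_integralT_nonmeas => [s|s|s].
- rewrite /= in_itv/= => /andP[s0 st]; apply: integral_ge0 => z _.
  by rewrite !mule_ge0 ?p_ge0 ?perturb_term_ge0// subr_gt0.
- rewrite /= in_itv/= => /andP[s0 st].
  apply: ge0_le_integral_nonmeas => z _.
    by rewrite !mule_ge0 ?p_ge0 ?perturb_term_ge0// subr_gt0.
  rewrite (pos_timeE _ _ _ s0); apply: lee_pmul.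
  + by rewrite mule_ge0 ?p_ge0.
  + by rewrite perturb_term_ge0// subr_gt0.
  + by rewrite lee_wpmul2l ?p_ge0.
  + by apply: IH; rewrite subr_gt0.
- apply: integral_ge0 => z _; rewrite !mule_ge0 ?pos_time_ge0//.
  by apply: conv_term_ge0 => //; exact: pos_time_ge0.
Qed.

End positive_times.

(** * Comparison with the perturbation by the measurable majorant [potential h g] *)

Theorem theorem1 (R : realType) (d : measure_display) (X : measurableType d)
  (m : {sigma_finite_measure set X -> \bar R})
  (p : R -> X -> X -> \bar R)
  (p_ge0 : forall (t : R) (x y : X), (0 < t)%R -> 0 <= p t x y)
  (p_meas : measurable_fun [set u : R * X * X | (0 < u.1.1)%R]
              (fun u : R * X * X => p u.1.1 u.1.2 u.2))
  (p_sym : forall (t : R) (x y : X), (0 < t)%R -> p t x y = p t y x)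
  (p_CK : forall (s t : R) (x z : X), (0 < s)%R -> (0 < t)%R ->
     \int[m]_y (p s x y * p t y z) = p (s + t)%R x z)
  (p_sigma_finite : forall (t : R) (x : X), (0 < t)%R ->
     sigma_finite [set: X] (fun A : set X => \int[m]_(y in A) p t x y))
  (f : R -> R)
  (f_ge0 : forall s : R, (0 <= f s)%R)
  (f_ndecr : forall r s : R, (r <= s)%R -> (f r <= f s)%R)
  (f_eq0 : forall s : R, (s <= 0)%R -> f s = 0%R)
  (mu : {sigma_finite_measure set X -> \bar R})
  (t : R) (x : X) (t_gt0 : (0 < t)%R) :
  \int[m]_y (perturbation m p (qfun p f mu) t x y * hfun p f mu y)
    <= hfun p f mu x.
Proof.
set P := pos_time p.
have P0 s y z : 0 <= P s y z by exact: pos_time_ge0.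
have Pm := measurable_pos_time _ p_meas.
have Ple0 s y z : (s <= 0)%R -> P s y z = 0 by exact: pos_time_le0.
have PCK s u y z : \int[m]_w (P s y w * P u w z) <= P (s + u)%R y z.
  have [s0|s0] := leP s 0%R.
    by rewrite integral0_eq// => w _; rewrite Ple0 ?mul0e.
  have [u0|u0] := leP u 0%R.
    by rewrite integral0_eq// => w _; rewrite (Ple0 u) ?mule0.
  rewrite /P pos_timeE ?addr_gt0// -p_CK//.
  by under eq_integral do rewrite !pos_timeE//.
have fm : measurable_fun [set: R] f by exact: nondecreasing_measurable.
pose h := weighted mu P (EFin \o f); pose g := weighted mu P (dini f).
have hE y : hfun p f mu y = h y by exact: hfun_weighted.
have f0 s : 0 <= (EFin \o f) s by rewrite lee_fin.
have d0 s : 0 <= dini f s by exact: dini_ge0.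
have h0 y : 0 <= h y by exact: weighted_ge0.
have g0 y : 0 <= g y by exact: weighted_ge0.
have hm : measurable_fun [set: X] h.
  by apply: (measurable_weighted mu P P0 Pm _ f0); exact/measurable_EFinP.
have gm : measurable_fun [set: X] g.
  by apply: (measurable_weighted mu P P0 Pm _ d0); exact: measurable_dini.
have qE y : qfun p f mu y = potential h (fun y =>
    \int[lebesgue_measure]_(s in `]0%R, +oo[)
      ((ae_derive f s)%:E * pmu p mu s y)) y.
  by rewrite /qfun /potential hE.
have q0 y : 0 <= qfun p f mu y.
  rewrite qE; apply: potential_ge0 => z; first exact: h0.
  exact: ae_derive_integral_ge0.
have qq' y : qfun p f mu y <= potential h g y.
  by rewrite qE; apply: le_potential; [exact: h0|exact: ae_derive_integral_le].
have qm : measurable_fun [set: X] (potential h g).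
  exact: measurable_potential.
have q'0 y : 0 <= potential h g y by exact: potential_ge0.
(* [excessive_bound] with [g] lowered to [potential h g * h]. *)
have hq s y : (0 < s)%R -> \int[m]_z (P s y z * h z) +
    \int[lebesgue_measure]_(r in `]0%R, s[)
      \int[m]_z (P r y z * (potential h g z * h z)) <= h y.
  move=> s0; apply: le_trans
    (excessive_bound m mu P P0 Pm PCK f f_ge0 f_ndecr s y s0).
  apply: leeD; [exact: lexx|apply: ge0_le_integral_nonmeas => u _].
    apply: integral_ge0 => z _; apply: mule_ge0; first exact: P0.
    by apply: mule_ge0; [exact: q'0|exact: h0].
  apply: ge0_le_integral_nonmeas => z _.
    apply: mule_ge0; first exact: P0.
    by apply: mule_ge0; [exact: q'0|exact: h0].
  by apply: lee_wpmul2l; [exact: P0|exact: potentialM_le].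
have pt0 n y := perturb_term_ge0 p p_ge0 m _ q0 n t x y t_gt0.
have ptle n y := perturb_term_le p p_ge0 m _ _ q0 qq' n t x y t_gt0.
rewrite hE; apply: le_trans _ (integral_conv_series_le m P P0 Pm Ple0
  (potential h g) h q'0 h0 qm hm hq t x).
apply: ge0_le_integral_nonmeas => y _; rewrite hE.
  apply: mule_ge0; last exact: h0.
  by apply: nneseries_ge0 => n _ _; exact: pt0.
apply: lee_wpmul2r; first exact: h0.
by apply: lee_nneseries => [n _ _|n _]; [exact: pt0|exact: ptle].
Qed.
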